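(* Let $L_p$ be the linear functional of orthogonality for the even-odd $q$-Lommel polynomials $p_n(x;c,q)$. Then, as formal power series in $t$, $$\sum_{n=0}^\infty L_p(x^n)t^n=\frac{{}_1\phi_1(0;cq;q,qt^2)}{{}_1\phi_1(0;c;q,t^2)}=\cfrac{1}{1-\cfrac{\lambda_1t^2}{1-\cfrac{\lambda_2t^2}{1-\cdots}}},$$ where $$\lambda_{2n}=\frac{cq^{3n-1}}{(1-cq^{2n-1})(1-cq^{2n})},\qquad\lambda_{2n+1}=\frac{q^n}{(1-cq^{2n})(1-cq^{2n+1})}.$$
   Context: $c,q$ are indeterminates; all series are formal power series in $t$ over $\mathbb{Q}(c,q)$, and the infinite continued fraction is the limit of its truncations. With $(a;q)_n=\prod_{i=0}^{n-1}(1-aq^i)$, $${}_1\phi_1(0;c;q,z)=\sum_{n\ge0}\frac{(-1)^nq^{\binom n2}}{(q;q)_n(c;q)_n}z^n .$$ The even-odd $q$-Lommel polynomials are defined by $p_{-1}=0$, $p_0=1$, $p_{n+1}(x;c,q)=x\,p_n(x;c,q)-\lambda_np_{n-1}(x;c,q)$ for $n\ge0$, with the $\lambda_n$ given in the statement. $L_p$ is the linear functional on polynomials in $x$ with $L_p(1)=1$ for which the $p_n$ are orthogonal: $L_p(p_mp_n)=0$ for $m\ne n$ (equivalently, $L_p(1)=1$ and $L_p(p_n)=0$ for $n\ge1$). *)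

(* Defs.v *)
From HB Require Import structures.
From mathcomp Require Import all_boot all_order all_algebra.
Set Implicit Arguments.
Unset Strict Implicit.
Unset Printing Implicit Defensive.
Import GRing.Theory.
Local Open Scope ring_scope.

(* The field Q(c,q): fractions of Q[q][c], with q the inner variable. *)
Definition Qcq : fieldType := {fraction {poly {poly rat}}}.
Definition c_ : Qcq := tofrac ('X : {poly {poly rat}}).
Definition q_ : Qcq := tofrac (('X : {poly rat})%:P : {poly {poly rat}}).

Section PowerSeries.
Variable K : fieldType.

(* A formal power series in t is its coefficient sequence. This is a record
   rather than nat -> K because MathComp's ring structure on functions is the
   pointwise one, not the Cauchy product. *)
Record fps := Fps { coefs : nat -> K }.

(* Equality of formal power series is equality of all coefficients. *)
Definition fps_eq (f g : fps) : Prop := coefs f =1 coefs g.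

Definition fps_const (a : K) : fps := Fps (fun n => if n == 0%N then a else 0).
Definition fps_t : fps := Fps (fun n => (n == 1%N)%:R).
Definition fps_sub (f g : fps) : fps := Fps (fun n => coefs f n - coefs g n).
Definition fps_mul (f g : fps) : fps :=
  Fps (fun n => \sum_(i < n.+1) coefs f i * coefs g (n - i)%N).
Definition fps_exp (f : fps) (n : nat) : fps :=
  iter n (fps_mul f) (fps_const 1).

(* The first n coefficients of 1/f, obtained by solving f * g = 1
   coefficient by coefficient. *)
Fixpoint fps_inv_seq (f : fps) (n : nat) : seq K :=
  if n is m.+1 then
    let s := fps_inv_seq f m in
    rcons s ((coefs f 0)^-1 *
             ((m == 0%N)%:R - \sum_(i < m) coefs f (m - i)%N * s`_i))
  else [::].

(* Meaningful only when f has a nonzero constant term; see fps_mulV. *)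
Definition fps_inv (f : fps) : fps := Fps (fun n => (fps_inv_seq f n.+1)`_n).
Definition fps_div (f g : fps) : fps := fps_mul f (fps_inv g).

(* \sum_(n >= 0) a_n z^n for a series z with zero constant term: then z^n
   has no term of degree < n, so the terms n > m do not contribute to t^m. *)
Definition fps_subst (a : nat -> K) (z : fps) : fps :=
  Fps (fun m => \sum_(n < m.+1) a n * coefs (fps_exp z n) m).

(* Convergence of formal power series (t-adic): every coefficient is
   eventually constant, equal to that of the limit. *)
Definition fps_cvg (u : nat -> fps) (l : fps) : Prop :=
  forall m, exists N, forall n, (N <= n)%N -> coefs (u n) m = coefs l m.

Lemma size_fps_inv_seq f n : size (fps_inv_seq f n) = n.
Proof. by elim: n => //= n IHn; rewrite size_rcons IHn. Qed.

Lemma nth_fps_inv_seq f n i :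
  (i < n)%N -> (fps_inv_seq f n)`_i = coefs (fps_inv f) i.
Proof.
elim: n => // n IHn; rewrite ltnS leq_eqVlt => /orP[/eqP -> //|lt_in].
by rewrite /= nth_rcons size_fps_inv_seq lt_in IHn.
Qed.

Lemma fps_mulV f :
  coefs f 0 != 0 -> fps_eq (fps_mul f (fps_inv f)) (fps_const 1).
Proof.
move=> f0 n; rewrite /fps_mul [LHS]/=.
rewrite (reindex_inj rev_ord_inj) /= big_ord_recr /=.
rewrite subSS subnn subn0.
rewrite -[(fps_inv_seq f n.+1)`_n]/(coefs (fps_inv f) n).
have -> : coefs (fps_inv f) n = (coefs f 0)^-1 * ((n == 0%N)%:R -
   \sum_(i < n) coefs f (n - i)%N * coefs (fps_inv f) i).
  rewrite {1}/fps_inv [LHS]/= nth_rcons size_fps_inv_seq ltnn eqxx.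
  congr (_ * (_ - _)); apply: eq_bigr => i _.
  by rewrite nth_fps_inv_seq.
rewrite mulVKf // addrC; under eq_bigr => i _ do
  rewrite subSS subKn ?(ltnW (ltn_ord i)) //.
by rewrite subrK; case: (n == 0%N).
Qed.

End PowerSeries.

Section QLommel.
Variable K : fieldType.
Implicit Types a c q : K.

Definition qpoch a q (n : nat) : K := \prod_(i < n) (1 - a * q ^+ i).

(* 1phi1(0; c; q, z), with z a power series without constant term. *)
Definition phi11 c q (z : fps K) : fps K :=
  fps_subst (fun n => (-1) ^+ n * q ^+ 'C(n, 2) / (qpoch q q n * qpoch c q n))
    z.

(* Used for n >= 1 only: the value at 0 is junk (truncated subtraction), but
   it occurs only as the factor of p_(-1) = 0. *)
Definition lam c q (n : nat) : K :=
  let m := n./2 in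
  if odd n then
    q ^+ m / ((1 - c * q ^+ (2 * m)) * (1 - c * q ^+ (2 * m + 1)))
  else
    c * q ^+ (3 * m - 1)
      / ((1 - c * q ^+ (2 * m - 1)) * (1 - c * q ^+ (2 * m))).

(* The innermost "else 0" is p_(-1). *)
Fixpoint qlommel c q (n : nat) : {poly K} :=
  if n is m.+1 then
    'X * qlommel c q m - lam c q m *: (if m is k.+1 then qlommel c q k else 0)
  else 1.

Definition orthogonality_functional (p : nat -> {poly K})
    (L : {scalar {poly K}}) : Prop :=
  L 1 = 1 /\ forall m n : nat, m != n -> L (p m * p n) = 0.

Definition moment_series (L : {scalar {poly K}}) : fps K :=
  Fps (fun n => L 'X^n).

(* 1/(1 - l_k t^2/(1 - l_(k+1) t^2/(... /(1 - l_(k+d-1) t^2)))) *)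
Fixpoint cfrac (l : nat -> K) (k d : nat) : fps K :=
  if d is d'.+1 then
    fps_div (fps_const 1)
      (fps_sub (fps_const 1)
         (fps_mul (fps_mul (fps_const (l k)) (fps_exp (fps_t K) 2))
                  (cfrac l k.+1 d')))
  else fps_const 1.

End QLommel.

(* Main.v *)
From HB Require Import structures.
Require Import Defs.
From mathcomp Require Import all_boot all_order all_algebra.
From mathcomp Require Import boolp ring.
Set Implicit Arguments.
Unset Strict Implicit.
Unset Printing Implicit Defensive.
Import GRing.Theory.
Local Open Scope ring_scope.

(** Put s_k = q^ceil(k/2) and F_k(t) = 1phi1(0; c q^k; q, s_k t^2).  Comparing
    coefficients of 1phi1(0; c; q, s t^2) gives two contiguous relations, one
    that keeps the argument s and one that turns it into q s
    ([phi11_contiguous], [phi11_contiguous_sq]).  Used alternately, for odd and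
    even k, they become the single three-term recurrence
      F_k = F_(k+1) - lambda_(k+1) t^2 F_(k+2)        ([phi11_chain_rec]),
    and the quotient of the theorem is F_1 / F_0.  What remains holds for any
    sequence of series F_k of constant term 1 that satisfies such a recurrence.

    Continued fraction: R_k = F_(k+1) / F_k satisfies
    R_k = 1 / (1 - lambda_(k+1) t^2 R_(k+1)), so replacing the tail of the
    fraction by 1 after d levels changes R_k only beyond degree d, since every
    level multiplies the error by t^2 ([cfrac_eq_upto]).

    Moments: multiplying the recurrence of the F_k by lambda_1 ... lambda_k t^k
    and dividing by F_0, the series
      H_k = lambda_1 ... lambda_k t^k F_(k+1) / F_0
    satisfy H_k - [k = 0] = t (H_(k+1) + lambda_k H_(k-1)), with H_(-1) = 0.
    The numbers L(x^n p_k) satisfy the same recurrence in n, because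
    x p_k = p_(k+1) + lambda_k p_(k-1), with the same initial values
    L(p_k) = [k = 0].  So L(x^n p_k) is the coefficient of t^n in H_k
    ([mixed_moments]), and k = 0 is the claim.

    The cancellations need only that no factor 1 - c q^n or 1 - q^(n+1)
    vanishes; for indeterminates this is seen by setting c = q = 0. *)

(** * The ring of formal power series *)

Section FpsRing.
Variable K : fieldType.
Implicit Types (f g h : fps K) (a b : K).

Lemma fps_ext f g : fps_eq f g -> f = g.
Proof. by case: f g => [f] [g] /= fg; congr Fps; apply/funext. Qed.

Definition fps_add f g : fps K := Fps (fun n => coefs f n + coefs g n).
Definition fps_opp f : fps K := Fps (fun n => - coefs f n).
Definition fps_trunc n f : {poly K} := \poly_(i < n) coefs f i.

(** The Cauchy product is the product of truncations, so the ring axioms can be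
    transferred from polynomials. *)
Lemma coef_mul_trunc n f g m : (m < n)%N ->
  coefs (fps_mul f g) m = (fps_trunc n f * fps_trunc n g)`_m.
Proof.
move=> lt_mn; rewrite coefM /=; apply: eq_bigr => i _; rewrite !coef_poly.
by rewrite !(leq_ltn_trans _ lt_mn) // ?leq_subr // -ltnS.
Qed.

Fact fps_addA : associative fps_add.
Proof. by move=> f g h; apply: fps_ext => n /=; rewrite addrA. Qed.
Fact fps_addC : commutative fps_add.
Proof. by move=> f g; apply: fps_ext => n /=; rewrite addrC. Qed.
Fact fps_add0 : left_id (fps_const 0) fps_add.
Proof. by move=> f; apply: fps_ext => n /=; rewrite if_same add0r. Qed.
Fact fps_addN : left_inverse (fps_const 0) fps_opp fps_add.
Proof. by move=> f; apply: fps_ext => n /=; rewrite if_same addNr. Qed.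

Fact fps_mulC : commutative (@fps_mul K).
Proof.
move=> f g; apply: fps_ext => n.
by rewrite !(@coef_mul_trunc n.+1) // mulrC.
Qed.

Fact fps_mulA : associative (@fps_mul K).
Proof.
move=> f g h; apply: fps_ext => n.
transitivity (fps_trunc n.+1 f * (fps_trunc n.+1 g * fps_trunc n.+1 h))`_n.
  rewrite coefM; apply: eq_bigr => i _.
  by rewrite (@coef_mul_trunc n.+1) ?ltnS ?leq_subr // coef_poly ltn_ord.
rewrite mulrA coefM; apply: eq_bigr => i _.
by rewrite (@coef_mul_trunc n.+1) // coef_poly ltnS leq_subr.
Qed.

Lemma coef_constM a f n : coefs (fps_mul (fps_const a) f) n = a * coefs f n.
Proof.
rewrite /= big_ord_recl /= subn0 big1 ?addr0 // => i _.
by rewrite mul0r.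
Qed.

Fact fps_mul1 : left_id (fps_const 1) (@fps_mul K).
Proof. by move=> f; apply: fps_ext => n; rewrite coef_constM mul1r. Qed.

Fact fps_mulDl : left_distributive (@fps_mul K) fps_add.
Proof.
move=> f g h; apply: fps_ext => n /=.
by rewrite -big_split; apply: eq_bigr => i _; rewrite /= mulrDl.
Qed.

Fact fps_one_neq0 : fps_const 1 <> fps_const 0 :> fps K.
Proof.
by move=> /(congr1 (fun f => coefs f 0)) /= /eqP; rewrite oner_eq0.
Qed.

(** With this structure, identities between series can be proved as identities
    in a commutative ring; [fps_ext] makes series with equal coefficients
    equal, and classical choice provides the decidable equality. *)
HB.instance Definition _ := gen_eqMixin (fps K).
HB.instance Definition _ := gen_choiceMixin (fps K).
HB.instance Definition _ :=
  GRing.isZmodule.Build (fps K) fps_addA fps_addC fps_add0 fps_addN.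
HB.instance Definition _ := GRing.Zmodule_isComNzRing.Build (fps K)
  fps_mulA fps_mulC fps_mul1 fps_mulDl (introN eqP fps_one_neq0).

Lemma fps_mulE f g : fps_mul f g = f * g. Proof. by []. Qed.
Lemma fps_subE f g : fps_sub f g = f - g. Proof. by []. Qed.
Lemma fps_const1 : fps_const 1 = 1 :> fps K. Proof. by []. Qed.
Lemma fps_expE f n : fps_exp f n = f ^+ n.
Proof. by elim: n => // n IHn; rewrite exprS -IHn. Qed.

Definition fpsE := (fps_mulE, fps_subE, fps_const1, fps_expE).

Lemma fps_constM a b : fps_const (a * b) = fps_const a * fps_const b.
Proof. by apply: fps_ext => -[|n]; rewrite coef_constM /= ?mulr0. Qed.

Lemma fps_constX a n : fps_const (a ^+ n) = fps_const a ^+ n.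
Proof. by elim: n => // n IHn; rewrite !exprS fps_constM IHn. Qed.

Lemma coef_tM f n :
  coefs (fps_t K * f) n = if n is m.+1 then coefs f m else 0.
Proof.
case: n => [|n]; rewrite /= big_ord_recl mul0r add0r ?big_ord0 // big_ord_recl.
by rewrite mul1r subSS subn0 big1 ?addr0 // => i _; rewrite mul0r.
Qed.

Lemma coef_tXM k f n :
  coefs (fps_t K ^+ k * f) n = if (n < k)%N then 0 else coefs f (n - k).
Proof.
by elim: k n => [|k IHk] [|n]; rewrite ?mul1r // exprS -mulrA coef_tM.
Qed.

Lemma coefD f g n : coefs (f + g) n = coefs f n + coefs g n.
Proof. by []. Qed.

Lemma coefB f g n : coefs (f - g) n = coefs f n - coefs g n.
Proof. by []. Qed.

Lemma coef0M f g : coefs (f * g) 0 = coefs f 0 * coefs g 0.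
Proof. by rewrite /= big_ord1. Qed.

Lemma fps_mulVr f : coefs f 0 != 0 -> f * fps_inv f = 1.
Proof. by move=> f0; apply/fps_ext/fps_mulV. Qed.

Lemma fps_inv_unique f g : coefs f 0 != 0 -> f * g = 1 -> fps_inv f = g.
Proof.
by move=> f0 fg; rewrite -[LHS]mulr1 -fg mulrA [_ * f]mulrC fps_mulVr ?mul1r.
Qed.

Definition eq_upto n f g := forall i, (i < n)%N -> coefs f i = coefs g i.

Lemma eq_upto_inv n f g : eq_upto n f g -> eq_upto n (fps_inv f) (fps_inv g).
Proof.
move=> fg i lt_in; rewrite -!(nth_fps_inv_seq _ lt_in); congr (_`_i).
elim: n fg {i lt_in} => //= n IHn fg.
rewrite (IHn (fun i lt_in => fg i (ltnW lt_in))) (fg 0) //.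
congr (rcons _ (_ * (_ - _))); apply: eq_bigr => i _.
by rewrite fg // ltnS leq_subr.
Qed.

End FpsRing.

(** * Three-term recurrences, continued fractions and moments *)

Section ContinuedFraction.
Variables (K : fieldType) (l : nat -> K) (F : nat -> fps K).
Local Notation t := (fps_t K).
Hypothesis F_coef0 : forall k, coefs (F k) 0 = 1.
Hypothesis F_rec : forall k,
  F k = F k.+1 - fps_const (l k.+1) * t ^+ 2 * F k.+2.

Let Funit k : coefs (F k) 0 != 0.
Proof. by rewrite F_coef0 oner_neq0. Qed.

(** Divide the recurrence by F_(k+1) and invert. *)
Lemma fps_inv_ratio k :
  fps_inv (1 - fps_const (l k.+1) * t ^+ 2 * fps_div (F k.+2) (F k.+1))
  = fps_div (F k.+1) (F k).
Proof.
have FV j : F j * fps_inv (F j) = 1 by exact: fps_mulVr.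
apply: fps_inv_unique.
  by rewrite coefB -mulrA coef_constM coef_tXM mulr0 subr0 oner_neq0.
rewrite /fps_div !fpsE -{}[RHS](FV k) {2}(F_rec k).
rewrite -[fps_const _ * _ * F k.+2]mulr1 -[in RHS](FV k.+1); ring.
Qed.

(** The base case d = 0 is the constant term 1 of the quotient; a level of the
    fraction gains two orders of t, of which only one is recorded. *)
Lemma cfrac_eq_upto d k :
  eq_upto d.+1 (cfrac l k.+1 d) (fps_div (F k.+1) (F k)).
Proof.
elim: d k => [|d IHd] k.
  move=> [|//] _; rewrite /fps_div coef0M F_coef0 mul1r.
  by rewrite /fps_inv /= big_ord0 F_coef0 invr1 subr0 mulr1.
have -> : cfrac l k.+1 d.+1 =
    fps_inv (1 - fps_const (l k.+1) * t ^+ 2 * cfrac l k.+2 d).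
  by rewrite -[RHS]mul1r -(fps_expE t 2).
rewrite -fps_inv_ratio.
apply: eq_upto_inv => i lt_id; rewrite !coefB; congr (_ - _).
rewrite -![fps_const _ * _ * _]mulrA !coef_constM !coef_tXM.
case: ltnP => // le2i.
by rewrite IHd // ltnS leq_subLR ltnW.
Qed.

Lemma cfrac_cvg k :
  fps_cvg (fun d => cfrac l k.+1 d) (fps_div (F k.+1) (F k)).
Proof. by move=> m; exists m => d le_md; apply: cfrac_eq_upto. Qed.

Variable p : nat -> {poly K}.
Hypothesis p0 : p 0 = 1.
Hypothesis p1 : p 1 = 'X.
Hypothesis p_rec : forall k, p k.+2 = 'X * p k.+1 - l k.+1 *: p k.

(** The generating function in n of the numbers L(x^n p_k). *)
Definition mixed_moment_series k : fps K :=
  fps_const (\prod_(i < k) l i.+1) * t ^+ k * fps_div (F k.+1) (F 0).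

Lemma mixed_moment_series0 :
  mixed_moment_series 0 = 1 + t * mixed_moment_series 1.
Proof.
rewrite /mixed_moment_series big_ord0 big_ord1 /fps_div !fpsE expr0 !mul1r.
have := fps_mulVr (Funit 0); set G := fps_inv _ => FG.
by rewrite -[X in X + _]FG (F_rec 0); ring.
Qed.

Lemma mixed_moment_seriesS k : mixed_moment_series k.+1 =
  t * mixed_moment_series k.+2
  + fps_const (l k.+1) * (t * mixed_moment_series k).
Proof.
rewrite /mixed_moment_series /fps_div !fpsE.
rewrite (F_rec k.+1) !big_ord_recr !fps_constM /= !exprS; ring.
Qed.

(** Induction on n, for all k at once: lowering n by one moves k by one in
    either direction. *)
Lemma mixed_moments (L : {scalar {poly K}}) n k :
  orthogonality_functional p L ->
  L ('X^n * p k) = coefs (mixed_moment_series k) n.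
Proof.
move=> [L1 Lorth].
elim: n k => [|n IHn] [|k].
- by rewrite p0 mulr1 expr0 L1 mixed_moment_series0 coefD coef_tM addr0.
- rewrite expr0 -p0 Lorth // /mixed_moment_series -mulrA coef_constM.
  by rewrite coef_tXM mulr0.
- rewrite mixed_moment_series0 coefD coef_tM add0r -IHn.
  by rewrite p0 p1 mulr1 exprSr.
- rewrite mixed_moment_seriesS coefD coef_constM !coef_tM.
  rewrite -!IHn p_rec -linearZ -linearD.
  congr (L _); rewrite exprSr mulrBr -scalerAr subrK mulrA //.
Qed.

(** The case k = 0 of [mixed_moments], as p_0 = 1 and H_0 = F_1 / F_0. *)
Lemma moment_series_ratio (L : {scalar {poly K}}) :
  orthogonality_functional p L ->
  moment_series L = fps_div (F 1) (F 0).
Proof.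
move=> Lorth; apply: fps_ext => n /=.
rewrite -['X^n]mulr1 -p0 mixed_moments //.
by rewrite /mixed_moment_series big_ord0 !mul1r.
Qed.

End ContinuedFraction.

(** * Contiguous relations for 1phi1 *)

Section QBessel.
Variables (K : fieldType) (q : K).
Hypothesis q_generic : forall n, 1 - q ^+ n.+1 != 0.
Local Notation t := (fps_t K).

Definition phi11_coef (c : K) n :=
  (-1) ^+ n * q ^+ 'C(n, 2) / (qpoch q q n * qpoch c q n).

Definition phi11_t2 c s := phi11 c q (fps_const s * t ^+ 2).

Lemma coef_phi11_t2 c s m : coefs (phi11_t2 c s) m =
  if odd m then 0 else phi11_coef c m./2 * s ^+ m./2.
Proof.
have coefz n : coefs (fps_exp (fps_const s * t ^+ 2) n) m =
    s ^+ n * (m == n.*2)%:R.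
  rewrite fpsE exprMn -fps_constX coef_constM -exprM mul2n.
  rewrite -[t ^+ _]mulr1 coef_tXM; congr (_ * _); case: ltngtP => //= [lt|->].
    by rewrite subn_eq0 leqNgt lt.
  by rewrite subnn.
rewrite /= ; under eq_bigr => n _ do rewrite coefz.
case: ifP => odd_m.
  rewrite big1 // => n _; case: eqP => [m2n|_]; last by rewrite !mulr0.
  by rewrite m2n odd_double in odd_m.
have lt_m2 : (m./2 < m.+1)%N.
  by rewrite ltnS leq_half_double -addnn -addnS leq_addr.
rewrite (bigD1 (Ordinal lt_m2)) //= even_halfK ?odd_m // eqxx mulr1.
rewrite big1 ?addr0 // => n neq; case: eqP => [m2n|_]; last by rewrite !mulr0.
by case/eqP: neq; apply: val_inj; rewrite /= -[LHS]doubleK -m2n.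
Qed.

Lemma qpochS a n : qpoch a q n.+1 = qpoch a q n * (1 - a * q ^+ n).
Proof. by rewrite /qpoch big_ord_recr. Qed.

Lemma qpochSl a n : qpoch a q n.+1 = (1 - a) * qpoch (a * q) q n.
Proof.
rewrite /qpoch big_ord_recl expr0 mulr1; congr (_ * _).
by apply: eq_bigr => i _; rewrite /= exprS mulrA.
Qed.

Lemma phi11_coef0 c : phi11_coef c 0 = 1.
Proof. by rewrite /phi11_coef /qpoch !big_ord0 !mulr1 divr1. Qed.

Lemma phi11_coefS c n : phi11_coef c n.+1 =
  - q ^+ n / ((1 - q ^+ n.+1) * (1 - c)) * phi11_coef (c * q) n.
Proof.
rewrite /phi11_coef binS bin1 exprD qpochS qpochSl -exprS [(-1) ^+ _.+1]exprS.
by rewrite !invfM; ring.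
Qed.

(** (c;q)_n (1 - c q^n) = (1 - c) (cq;q)_n: the only change under c -> c q is
    at the two ends of the product. *)
Lemma phi11_coef_shift c n : 1 - c != 0 -> 1 - c * q ^+ n != 0 ->
  phi11_coef c n = (1 - c * q ^+ n) / (1 - c) * phi11_coef (c * q) n.
Proof.
move=> c_neq1 cqn_neq1; rewrite /phi11_coef; set a := _ * _ ^+ 'C(n, 2).
have -> : qpoch c q n = (1 - c) * qpoch (c * q) q n / (1 - c * q ^+ n).
  by rewrite -qpochSl qpochS mulfK.
by rewrite !invfM invrK; ring.
Qed.

Section Contiguous.
Variable c : K.
Hypothesis c_neq1 : 1 - c != 0.
Hypothesis c_generic : forall n, 1 - c * q * q ^+ n != 0.

Let cq_neq1 : 1 - c * q != 0.
Proof. by have := c_generic 0; rewrite mulr1. Qed.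

Let c_genericS n : 1 - c * q ^+ n.+1 != 0.
Proof. by rewrite exprS mulrA. Qed.

(** With a_n(c) = [phi11_coef c n], both contiguous relations say that
    a_(n+1)(c) - u a_(n+1)(c q) is a multiple of a_n(c q^2), with u = q^(n+1)
    here and u = 1 in the next lemma: by [phi11_coef_shift] and [phi11_coefS]
    all three are rational multiples of one another, and the difference gains
    the factor 1 - q^(n+1) that cancels the denominator of [phi11_coefS]. *)
Lemma phi11_contiguous_sq s : phi11_t2 c s = phi11_t2 (c * q) (q * s)
  - fps_const (s / ((1 - c) * (1 - c * q))) * t ^+ 2
    * phi11_t2 (c * q ^+ 2) (q * s).
Proof.
apply: fps_ext => -[|[|m]]; rewrite coefB -[fps_const _ * _ * _]mulrA;
  rewrite coef_constM coef_tXM !coef_phi11_t2 /=.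
- by rewrite !phi11_coef0 mulr0 subr0.
- by rewrite mulr0 subr0.
rewrite subn2 /= negbK; case: ifP => _; first by rewrite mulr0 subr0.
have [qn cn] := (q_generic m./2, c_genericS m./2).
rewrite phi11_coef_shift // phi11_coefS [c * q ^+ 2]mulrA !exprMn !exprS.
by rewrite !exprS in qn cn *; field; apply/and3P.
Qed.

Lemma phi11_contiguous s : phi11_t2 c s = phi11_t2 (c * q) s
  - fps_const (c * s / ((1 - c) * (1 - c * q))) * t ^+ 2
    * phi11_t2 (c * q ^+ 2) (q * s).
Proof.
apply: fps_ext => -[|[|m]]; rewrite coefB -[fps_const _ * _ * _]mulrA;
  rewrite coef_constM coef_tXM !coef_phi11_t2 /=.
- by rewrite !phi11_coef0 mulr0 subr0.
- by rewrite mulr0 subr0.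
rewrite subn2 /= negbK; case: ifP => _; first by rewrite mulr0 subr0.
have [qn cn] := (q_generic m./2, c_genericS m./2).
rewrite phi11_coef_shift // phi11_coefS [c * q ^+ 2]mulrA !exprMn !exprS.
by rewrite !exprS in qn cn *; field; apply/and3P.
Qed.

End Contiguous.

Variable c : K.
Hypothesis c_generic : forall n, 1 - c * q ^+ n != 0.

(** Each step multiplies c by q, and every second one multiplies the argument
    by q: the argument changes between k and k + 1 exactly when k is even. *)
Definition phi11_chain k := phi11_t2 (c * q ^+ k) (q ^+ uphalf k).

Lemma phi11_chain_coef0 k : coefs (phi11_chain k) 0 = 1.
Proof. by rewrite coef_phi11_t2 phi11_coef0 mulr1. Qed.

(** The parity-free shape of lambda: its two cases are the factors s and c s of
    the two contiguous relations, taken at c q^k and s = q^ceil(k/2). *)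
Lemma lam_chain k : lam c q k.+1 =
  (if odd k then c * q ^+ k * q ^+ uphalf k else q ^+ uphalf k)
  / ((1 - c * q ^+ k) * (1 - c * q ^+ k.+1)).
Proof.
rewrite /lam /=; case: (boolP (odd k)) => k_odd /=.
  have def_k : (2 * uphalf k)%N = k.+1.
    rewrite mul2n uphalf_half k_odd -[in RHS](odd_double_half k) k_odd.
    by rewrite doubleS.
  rewrite -[3%N]/(2 + 1)%N mulnDl def_k mul1n addSn !subn1 /=.
  by rewrite exprD mulrA.
have -> : (2 * uphalf k)%N = k.
  by rewrite mul2n uphalf_half (negPf k_odd) even_halfK.
by rewrite addn1.
Qed.

Lemma phi11_chain_rec k : phi11_chain k =
  phi11_chain k.+1 - fps_const (lam c q k.+1) * t ^+ 2 * phi11_chain k.+2.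
Proof.
have gen n : 1 - c * q ^+ k * q * q ^+ n != 0.
  by rewrite -!mulrA -exprS -exprD.
rewrite /phi11_chain lam_chain.
have -> : c * q ^+ k.+1 = c * q ^+ k * q by rewrite exprSr mulrA.
have -> : c * q ^+ k.+2 = c * q ^+ k * q ^+ 2 by rewrite -addn2 exprD mulrA.
have -> : q ^+ uphalf k.+2 = q * q ^+ uphalf k by rewrite -exprS.
case: (boolP (odd k)) => k_odd.
  have -> : uphalf k.+1 = uphalf k by rewrite [RHS]uphalf_half k_odd.
  exact: phi11_contiguous.
have -> : uphalf k.+1 = (uphalf k).+1.
  by rewrite [uphalf k]uphalf_half (negPf k_odd).
by rewrite exprS; exact: phi11_contiguous_sq.
Qed.

End QBessel.

(** * The field of rational functions in c and q *)

(** Evaluation at c = 0, then at q = 0, sends 1 - p to 1. *)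
Lemma one_sub_neq0 (p : {poly {poly rat}}) :
  p.[0].[0] = 0 -> 1 - tofrac p != 0 :> Qcq.
Proof.
move=> p0; rewrite -tofrac1 -tofracB tofrac_eq0; apply/eqP.
move=> /(congr1 (fun r : {poly {poly rat}} => r.[0].[0])) /eqP.
by rewrite !hornerE p0 subr0 oner_eq0.
Qed.

Lemma c_generic n : 1 - c_ * q_ ^+ n != 0.
Proof.
by rewrite -tofracXn -tofracM one_sub_neq0 // !hornerE.
Qed.

Lemma q_generic n : 1 - q_ ^+ n.+1 != 0.
Proof.
by rewrite -tofracXn one_sub_neq0 // -polyC_exp hornerC hornerXn expr0n.
Qed.

Theorem theorem5p4 (L : {scalar {poly Qcq}})
    (hL : orthogonality_functional (qlommel c_ q_) L) :
  let t2 := fps_exp (fps_t Qcq) 2 in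
  let quotient := fps_div (phi11 (c_ * q_) q_ (fps_mul (fps_const q_) t2))
                          (phi11 c_ q_ t2) in
  fps_eq (moment_series L) quotient /\
  fps_cvg (fun d => cfrac (lam c_ q_) 1 d) quotient.
Proof.
move=> t2 quotient.
have -> : quotient = fps_div (phi11_chain q_ c_ 1) (phi11_chain q_ c_ 0).
  rewrite /quotient /t2 /phi11_chain /phi11_t2 !fpsE !expr0 !expr1 mulr1.
  by rewrite mul1r.
have chain_rec := phi11_chain_rec q_generic c_generic.
split; last exact: (cfrac_cvg (phi11_chain_coef0 q_ c_) chain_rec 0).
rewrite -(moment_series_ratio (phi11_chain_coef0 q_ c_) chain_rec _ _ _ hL) //.
by rewrite /= mulr1 scaler0 subr0.
Qed.
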